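(* Let $J_1$ be the first Janko group. Let $p,q,r \in \{2,3,5,7,11,19\}$ with $p<q<r$. Then $J_1$ is $(p,q,r)$-generated, except when $(p,q,r)=(2,3,5)$, in which case $J_1$ is not $(2,3,5)$-generated.
   Context: The Janko group $J_1$ is the sporadic simple group of order $175560 = 2^3\cdot 3\cdot 5\cdot 7\cdot 11\cdot 19$ (it is, up to isomorphism, the unique simple group of this order). For positive integers $l,m,n$, a group $G$ is called $(l,m,n)$-generated if there are elements $a,b\in G$ with $G=\langle a,b\rangle$, $o(a)=l$, $o(b)=m$ and $o(ab)=n$, where $o(x)$ denotes the order of $x$. *)

(* Defs.v *)
From Stdlib Require Import BinNat.
From mathcomp Require Import all_boot all_order all_algebra.
From mathcomp Require Import all_fingroup all_solvable.
From mathcomp Require Import zify.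

Set Implicit Arguments.
Unset Strict Implicit.
Unset Printing Implicit Defensive.

Import GRing.Theory.

Definition triple_generated (gT : finGroupType) (G : {group gT})
    (l m n : nat) : Prop :=
  exists a b : gT,
    [/\ a \in G, b \in G & G :=: <<[set a; b]>>%g] /\
    [/\ #[a]%g = l, #[b]%g = m & #[a * b]%g = n].

Definition mx_of_rows (s : seq (seq int)) : 'M['F_11]_7 :=
  (\matrix_(i, j) (nth 0 (nth [::] s i) j)%:~R)%R.

(* Janko's description of J_1 (A new finite simple group with abelian Sylow
   2-subgroups and its characterization, J. Algebra 3, 1966): the subgroup of
   GL_7(11) generated by the following two matrices, of orders 7 and 5.  The
   theorems card_J1 and simple_J1 below show that it is a simple group of order
   175560, and hence, by Janko's uniqueness theorem, the group J_1. *)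
Definition janko_Y : 'M['F_11]_7 := mx_of_rows
  [:: [:: 0; 1; 0; 0; 0; 0; 0];
      [:: 0; 0; 1; 0; 0; 0; 0];
      [:: 0; 0; 0; 1; 0; 0; 0];
      [:: 0; 0; 0; 0; 1; 0; 0];
      [:: 0; 0; 0; 0; 0; 1; 0];
      [:: 0; 0; 0; 0; 0; 0; 1];
      [:: 1; 0; 0; 0; 0; 0; 0]]%R.

Definition janko_Z : 'M['F_11]_7 := mx_of_rows
  [:: [:: -3;  2; -1; -1; -3; -1; -3];
      [:: -2;  1;  1;  3;  1;  3;  3];
      [:: -1; -1; -3; -1; -3; -3;  2];
      [:: -1; -3; -1; -3; -3;  2; -1];
      [:: -3; -1; -3; -3;  2; -1; -1];
      [::  1;  3;  3; -2;  1;  1;  3];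
      [::  3;  3; -2;  1;  1;  3;  1]]%R.

(* Matrices over F_11 as tables of binary numbers, for computation. *)
Definition table := seq (seq N).

Definition code (A : 'M['F_11]_7) : table :=
  mkseq (fun i => mkseq (fun j => bin_of_nat (A (inord i) (inord j))) 7) 7.

Definition dot (r : seq N) (B : table) (j : nat) : N :=
  foldr (fun k s => (nth 0 r k * nth 0 (nth [::] B k) j + s)%num) 0%num
        (iota 0 7).

Definition mul_table (A B : table) : table :=
  mkseq (fun i => let r := nth [::] A i in
           mkseq (fun j => N.modulo (dot r B j) 11) 7) 7.

Definition one_table : table :=
  mkseq (fun i => mkseq (fun j => N.b2n (i == j)) 7) 7.

Definition y_table : table :=
  mkseq (fun i => mkseq (fun j => N.b2n (j == i.+1 %% 7)) 7) 7.

Definition z_table : table :=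
  [:: [:: 8; 2; 10; 10; 8; 10; 8];
      [:: 9; 1; 1; 3; 1; 3; 3];
      [:: 10; 10; 8; 10; 8; 8; 2];
      [:: 10; 8; 10; 8; 8; 2; 10];
      [:: 8; 10; 8; 8; 2; 10; 10];
      [:: 1; 3; 3; 9; 1; 1; 3];
      [:: 3; 3; 9; 1; 1; 3; 1]]%num.

Lemma nat_of_add_bin (a b : N) :
  nat_of_bin (a + b)%num = nat_of_bin a + nat_of_bin b.
Proof. by case: a b => [|p] [|q]; rewrite ?addn0 //= nat_of_add_pos. Qed.

Lemma nat_of_mul_bin (a b : N) :
  nat_of_bin (a * b)%num = nat_of_bin a * nat_of_bin b.
Proof. by case: a b => [|p] [|q]; rewrite ?muln0 //= nat_of_mul_pos. Qed.

Lemma nat_of_binM11 (a : N) : nat_of_bin (N.modulo a 11) = nat_of_bin a %% 11.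
Proof.
have lt_r : nat_of_bin (N.modulo a 11) < 11.
  have := N.mod_lt a 11 ltac:(by []).
  by case: (N.modulo a 11) => // -[[[[]|[]|]|[[]|[]|]|]|[[[]|[]|]|[[]|[]|]|]|].
rewrite {2}(N.div_mod a 11) // nat_of_add_bin nat_of_mul_bin mulnC.
by rewrite modnMDl modn_small.
Qed.

Lemma code_inj : injective code.
Proof.
move=> A B eqAB; apply/matrixP=> i j.
have /(congr1 (fun t => nth 0%num (nth [::] t i) j)) := eqAB.
rewrite /code !nth_mkseq ?ltn_ord // !inord_val.
by move/(can_inj bin_of_natK)/val_inj.
Qed.

Lemma foldr_sumE (F : nat -> N) (s : seq nat) :
  nat_of_bin (foldr (fun k t => (F k + t)%num) 0%num s) =
  \sum_(k <- s) nat_of_bin (F k).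
Proof.
by elim: s => [|k s IHs]; rewrite ?big_nil // big_cons -IHs /= nat_of_add_bin.
Qed.

Lemma codeE (A : 'M['F_11]_7) (i j : 'I_7) :
  nat_of_bin (nth 0%num (nth [::] (code A) i) j) = A i j.
Proof. by rewrite /code !nth_mkseq // !inord_val bin_of_natK. Qed.

Lemma dotE (A B : 'M['F_11]_7) (i j : 'I_7) :
  nat_of_bin (dot (nth [::] (code A) i) (code B) j) =
  \sum_(k < 7) (A i k : nat) * (B k j : nat).
Proof.
rewrite /dot foldr_sumE -[iota 0 7]/(index_iota 0 7) big_mkord.
by apply: eq_bigr => k _; rewrite nat_of_mul_bin !codeE.
Qed.

Lemma codeM (A B : 'M['F_11]_7) : code (A *m B) = mul_table (code A) (code B).
Proof.
apply/eq_in_map => i; rewrite mem_iota => /= lt_i.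
apply/eq_in_map => j; rewrite mem_iota => /= lt_j.
apply: (can_inj nat_of_binK); rewrite bin_of_natK nat_of_binM11.
rewrite -{2}(inordK lt_i) -{2}(inordK lt_j) dotE -(@val_Fp_nat 11) //.
rewrite mxE natr_sum; congr (nat_of_ord _).
by apply: eq_bigr => k _; rewrite natrM !natr_Zp.
Qed.

Lemma code1 : code 1%:M = one_table.
Proof.
apply/eq_in_map => i; rewrite mem_iota => /= lt_i.
apply/eq_in_map => j; rewrite mem_iota => /= lt_j.
by rewrite mxE -val_eqE /= !inordK //; case: eqP.
Qed.

Lemma code_rows (s : seq (seq int)) :
  code (mx_of_rows s) =
  mkseq (fun i => mkseq (fun j =>
    bin_of_nat ((nth 0 (nth [::] s i) j)%:~R : 'F_11)%R) 7) 7.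
Proof.
apply/eq_in_map => i; rewrite mem_iota => /= lt_i.
apply/eq_in_map => j; rewrite mem_iota => /= lt_j.
by rewrite mxE !inordK.
Qed.

Lemma codeY : code janko_Y = y_table.
Proof. by rewrite code_rows; vm_compute. Qed.

Lemma codeZ : code janko_Z = z_table.
Proof. by rewrite code_rows; vm_compute. Qed.

Lemma janko_Y_unit : janko_Y \is a GRing.unit.
Proof.
have /mulmx1_unit[unit_Y _] :
    (janko_Y *m iter 5 (mulmx janko_Y) janko_Y = 1%:M)%R.
  by apply: code_inj; rewrite /= !codeM codeY code1; vm_compute.
exact: unit_Y.
Qed.

Lemma janko_Z_unit : janko_Z \is a GRing.unit.
Proof.
have /mulmx1_unit[unit_Z _] :
    (janko_Z *m iter 3 (mulmx janko_Z) janko_Z = 1%:M)%R.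
  by apply: code_inj; rewrite /= !codeM codeZ code1; vm_compute.
exact: unit_Z.
Qed.

Definition J1_Y : {'GL_7(11)} := FinRing.Unit janko_Y_unit.
Definition J1_Z : {'GL_7(11)} := FinRing.Unit janko_Z_unit.

Definition J1 : {group {'GL_7(11)}} := <<[set J1_Y; J1_Z]>>%G.

Definition glcode (g : {'GL_7(11)}) : table := code (GLval g).

Lemma glcode_inj : injective glcode.
Proof. by move=> g h eq_gh; apply/val_inj/code_inj. Qed.

Lemma glcodeM : {morph glcode : g h / (g * h)%g >-> mul_table g h}.
Proof. by move=> g h; rewrite /glcode GL_MxE codeM. Qed.

Lemma glcode1 : glcode 1%g = one_table.
Proof. exact: code1. Qed.

(* A word in a list of generators is a list of positions in it.  A Schreier
   tree lists the coset representatives other than 1 as pairs (position of the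
   parent representative, position of the generator); entry (h, k) of a coset
   table, at representative x and generator g, says that x g is the h-th
   element of the subgroup times the k-th representative. *)
Section Words.
Variables (T : eqType) (op : T -> T -> T) (e : T).

Definition word (gens : seq T) (w : seq nat) : T :=
  foldl (fun x k => op x (nth e gens k)) e w.

Definition grow (gens : seq T) (tree : seq (nat * nat)) : seq T :=
  foldl (fun X p => rcons X (op (nth e X p.1) (nth e gens p.2))) [:: e] tree.

Definition prods (s t : seq T) : seq T := [seq op x y | x <- s, y <- t].

Definition covers (els gens X : seq T) (tab : seq (seq (nat * nat))) : bool :=
  all2 (fun x =>
    all2 (fun g p => op x g == op (nth e els p.1) (nth e X p.2)) gens) X tab.

Lemma size_grow gens tree : size (grow gens tree) = (size tree).+1.
Proof.
rewrite /grow -[(size tree).+1]/(size [:: e] + size tree).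
elim: tree [:: e] => [|p tree IHt] X /=; first by rewrite addn0.
by rewrite IHt size_rcons addnS.
Qed.

End Words.

Section WordsMap.
Variables (T U : eqType) (opT : T -> T -> T) (opU : U -> U -> U).
Variables (eT : T) (eU : U) (f : T -> U).
Hypotheses (fM : {morph f : x y / opT x y >-> opU x y}) (f1 : f eT = eU).
Hypothesis f_inj : injective f.

Lemma nth_map1 s k : nth eU (map f s) k = f (nth eT s k).
Proof.
have [lt_k | le_k] := ltnP k (size s); first exact: nth_map.
by rewrite !nth_default ?size_map.
Qed.

Lemma map_word gens w : f (word opT eT gens w) = word opU eU (map f gens) w.
Proof.
rewrite /word.
have aux x : f (foldl (fun x k => opT x (nth eT gens k)) x w) =
    foldl (fun y k => opU y (nth eU (map f gens) k)) (f x) w.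
  by elim: w x => //= k w IHw x; rewrite IHw fM nth_map1.
by rewrite aux f1.
Qed.

Lemma map_grow gens gensU tree : gensU = map f gens ->
  grow opU eU gensU tree = map f (grow opT eT gens tree).
Proof.
move=> ->; rewrite /grow; symmetry.
have aux X : map f (foldl (fun X p =>
      rcons X (opT (nth eT X p.1) (nth eT gens p.2))) X tree) =
    foldl (fun Y p => rcons Y (opU (nth eU Y p.1) (nth eU (map f gens) p.2)))
          (map f X) tree.
  by elim: tree X => //= p t IHt X; rewrite IHt map_rcons fM !nth_map1.
by rewrite aux /= f1.
Qed.

Lemma map_prods s t sU tU : sU = map f s -> tU = map f t ->
  prods opU sU tU = map f (prods opT s t).
Proof.
move=> -> ->; rewrite /prods; symmetry.
elim: s => //= x s IHs; rewrite map_cat; congr (_ ++ _); last exact: IHs.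
by rewrite -!map_comp; apply: eq_map => y /=; apply: fM.
Qed.

Lemma covers_map els gens X tab elsU gensU XU :
  elsU = map f els -> gensU = map f gens -> XU = map f X ->
  covers opU eU elsU gensU XU tab -> covers opT eT els gens X tab.
Proof.
move=> -> -> ->; rewrite /covers.
elim: {2 4}X tab => [|x Y IHY] [|t tab] //=.
case/andP=> t_ok /IHY ->; rewrite andbT; clear IHY.
elim: gens t t_ok => [|g gens IHg] [|p t] //= /andP[p_ok /IHg ->].
by rewrite andbT -(inj_eq f_inj) !fM -!nth_map1.
Qed.

End WordsMap.

Lemma leq_card_coset_cover (gT : finGroupType) (H : {group gT})
    (els gens X : seq gT) (tab : seq (seq (nat * nat))) :
    {subset els <= H} -> 1%g \in X -> covers *%g 1%g els gens X tab ->
  #|<<[set x in gens]>>%g| <= #|H| * size X.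
Proof.
rewrite /covers => sHels X1 cov; set S := (H * [set x in X])%g.
pose K := [set g | S :* g \subset S]%g.
have S1 : (1 \in S)%g.
  by apply/mulsgP; exists 1%g 1%g; rewrite ?inE ?group1 ?mulg1.
have K_group : group_set K.
  apply/group_setP; split=> [|g h]; first by rewrite inE mulg1.
  rewrite !inE => sSg sSh; rewrite rcosetM.
  exact: subset_trans (mulSg _ sSg) sSh.
have sgK : [set x in gens] \subset K.
  apply/subsetP=> g; rewrite inE => gens_g; rewrite inE.
  apply/subsetP=> _ /rcosetP[_ /mulsgP[h x Hh + ->] ->]; rewrite inE => X_x.
  have nth_in (A : {pred gT}) (s : seq gT) k :
      1%g \in A -> {subset s <= A} -> nth 1%g s k \in A.
    move=> A1 sA; case: (ltnP k (size s)) => [lt_k | le_k].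
      exact/sA/mem_nth.
    by rewrite nth_default.
  have [p /eqP eq_xg] : exists p : nat * nat,
      (x * g == nth 1 els p.1 * nth 1 X p.2)%g.
    elim: {1 3}X tab X_x cov => [|y Y IHY] [|t tab'] //=.
    rewrite inE => /predU1P[<- /andP[t_ok _] | Y_x /andP[_]]; last exact: IHY.
    clear IHY; elim: gens t gens_g t_ok => [|g0 s IHs] [|p t] //=.
    rewrite inE => /predU1P[<- /andP[p_ok _] | s_g /andP[_]]; first by exists p.
    exact: IHs.
  rewrite -mulgA eq_xg mulgA; apply: mem_mulg; last by rewrite inE nth_in.
  by rewrite groupM ?nth_in.
have sGS : <<[set x in gens]>>%g \subset S.
  apply/subsetP=> g G_g.
  have : g \in Group K_group by apply: subsetP G_g; rewrite gen_subG.
  rewrite inE => /subsetP sSg; rewrite -[g]mul1g.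
  by apply: sSg; rewrite mem_rcoset mulgK.
apply: leq_trans (subset_leq_card sGS) _.
apply: leq_trans (_ : #|H| * #|[set x in X]| <= _).
  rewrite -cardsX /S -[(H * _)%g]/(mulg @2: (H, [set x in X])).
  by rewrite curry_imset2X leq_imset_card.
by rewrite leq_mul2l cardsE card_size orbT.
Qed.

Lemma card_gens_reps (gT : finGroupType) (H : {group gT})
    (els gens X : seq gT) (tree : seq (nat * nat))
    (tab : seq (seq (nat * nat))) :
    {subset els <= H} -> H \subset <<[set g in gens]>>%g ->
    X = grow *%g 1%g gens tree -> covers *%g 1%g els gens X tab ->
  #|<<[set g in gens]>>%g| <= #|H| * (size tree).+1 /\
  {subset prods *%g els X <= <<[set g in gens]>>%G}.
Proof.
move=> sHels sHK X_E cov; set K := <<_>>%G.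
have X1 : 1%g \in X.
  rewrite X_E /grow; elim/last_ind: tree {X_E} => [|t p IHt].
    exact: mem_head.
  by rewrite foldl_rcons mem_rcons inE IHt orbT.
have genK k : nth 1%g gens k \in K.
  have [lt_k | le_k] := ltnP k (size gens); last by rewrite nth_default.
  by rewrite mem_gen // inE mem_nth.
have sXK : {subset X <= K}.
  rewrite X_E /grow {X X1 X_E cov}; elim/last_ind: tree => [|t p IHt] x.
    by rewrite inE => /eqP->.
  rewrite foldl_rcons mem_rcons inE => /predU1P[-> | /IHt //].
  apply: groupM; last exact: genK.
  set Y := foldl _ _ _ in IHt *.
  have [lt_k | le_k] := ltnP p.1 (size Y); last by rewrite nth_default.
  exact/IHt/mem_nth.
split.
  rewrite -(size_grow *%g 1%g gens tree) -X_E.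
  exact: leq_card_coset_cover sHels X1 cov.
move=> _ /allpairsP[[h x] /= [els_h X_x ->]].
by apply: groupM; [apply/(subsetP sHK)/sHels | apply: sXK].
Qed.

Lemma mem_word (gT : finGroupType) (G : {group gT}) (gens : seq gT)
    (w : seq nat) :
  {subset gens <= G} -> word *%g 1%g gens w \in G.
Proof.
move=> sG; rewrite /word; elim/last_ind: w => [|w k IHw]; first exact: group1.
rewrite foldl_rcons; apply: groupM; first exact: IHw.
have [lt_k | le_k] := ltnP k (size gens); last by rewrite nth_default.
exact/sG/mem_nth.
Qed.

Definition tree0 : seq (nat * nat) :=
  [:: (0,0);(1,0);(2,0);(3,0);(4,0);(5,0);(6,0);(7,0);(8,0);(9,0)].

Definition table0 : seq (seq (nat * nat)) :=
  [:: [:: (0,1)];[:: (0,2)];[:: (0,3)];[:: (0,4)];[:: (0,5)];[:: (0,6)];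
  [:: (0,7)];[:: (0,8)];[:: (0,9)];[:: (0,10)];[:: (0,0)]].

Definition tree1 : seq (nat * nat) :=
  [:: (0,1);(1,1);(2,1);(3,1)].

Definition table1 : seq (seq (nat * nat)) :=
  [:: [:: (1,0);(0,1)];[:: (4,1);(0,2)];[:: (5,2);(0,3)];[:: (9,3);(0,4)];
  [:: (3,4);(0,0)]].

Definition tree2 : seq (nat * nat) :=
  [:: (0,2);(1,0);(1,1);(1,2);(2,0);(2,1);(3,0);(4,0);(4,2);(6,1);(9,0)].

Definition table2 : seq (seq (nat * nat)) :=
  [:: [:: (5,0);(1,0);(0,1)];[:: (0,2);(0,3);(0,4)];[:: (0,5);(0,6);(50,0)];
  [:: (0,7);(10,4);(6,7)];[:: (0,8);(4,8);(0,9)];[:: (52,9);(39,1);(43,5)];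
  [:: (11,4);(0,10);(46,3)];[:: (26,10);(33,2);(50,10)];[:: (23,1);(7,5);
  (12,8)];[:: (0,11);(9,9);(5,2)];[:: (39,6);(49,11);(9,11)];[:: (54,3);
  (48,7);(29,6)]].

Definition tree3 : seq (nat * nat) :=
  [:: (0,0);(0,1);(1,0);(1,1);(2,0);(2,1);(3,0);(4,0);(5,0);(5,1);(6,0);(7,0);
  (7,1);(8,0);(8,1);(9,0);(9,1);(10,0);(10,1);(11,0);(13,0);(13,1);(14,0);
  (14,1);(15,0);(15,1);(16,0);(16,1);(17,0);(17,1);(18,0);(18,1);(19,0);
  (20,0);(20,1);(21,0);(21,1);(22,0);(22,1);(23,0);(23,1);(24,1);(25,0);
  (25,1);(26,0);(26,1);(27,0);(28,0);(29,1);(31,0);(31,1);(32,0);(32,1);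
  (33,0);(33,1);(34,0);(35,0);(36,1);(37,0);(38,0);(38,1);(39,0);(39,1);
  (40,0);(40,1);(41,0);(41,1);(42,0);(42,1);(43,0);(43,1);(44,0);(44,1);
  (45,0);(45,1);(46,0);(46,1);(47,0);(48,1);(49,1);(50,0);(50,1);(51,0);
  (51,1);(52,0);(52,1);(53,0);(53,1);(54,0);(55,0);(56,1);(58,0);(58,1);
  (59,0);(60,0);(60,1);(61,0);(61,1);(62,0);(64,0);(66,1);(67,0);(67,1);
  (69,0);(70,1);(71,1);(72,0);(72,1);(73,0);(74,0);(74,1);(75,0);(75,1);
  (76,0);(76,1);(77,0);(79,0);(79,1);(80,0);(80,1);(81,1);(82,0);(83,0);
  (83,1);(84,1);(85,0);(85,1);(86,0);(86,1);(89,0);(91,0);(91,1);(92,0);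
  (92,1);(93,0);(96,0);(96,1);(97,0);(97,1);(98,0);(99,0);(101,0);(101,1);
  (102,0);(102,1);(103,0);(103,1);(104,0);(105,0);(105,1);(106,1);(107,0);
  (107,1);(108,0);(108,1);(109,0);(109,1);(110,0);(110,1);(111,0);(111,1);
  (112,0);(112,1);(113,0);(114,0);(114,1);(115,0);(115,1);(117,1);(118,0);
  (118,1);(119,0);(119,1);(120,0);(121,1);(122,1);(123,1);(124,0);(124,1);
  (125,0);(126,0);(126,1);(127,0);(128,0);(128,1);(129,0);(131,1);(133,0);
  (134,0);(134,1);(136,0);(136,1);(138,1);(139,0);(140,0);(140,1);(141,1);
  (142,1);(143,0);(143,1);(144,1);(145,0);(146,0);(146,1);(147,0);(148,0);
  (149,1);(150,0);(151,0);(152,0);(153,0);(154,0);(154,1);(155,0);(155,1);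
  (158,0);(158,1);(159,0);(160,0);(162,0);(162,1);(163,0);(163,1);(164,1);
  (167,0);(168,0);(168,1);(169,1);(170,1);(171,0);(172,1);(174,0);(178,0);
  (180,0);(182,1);(184,0);(186,1);(187,0);(188,1);(189,1);(192,0);(193,1);
  (195,1);(196,0);(197,0);(197,1);(198,1);(199,0);(199,1);(210,0);(212,0);
  (216,0);(216,1);(221,1);(222,1);(224,1);(225,0);(227,0);(228,0);(230,0);
  (235,1);(236,1);(237,1);(238,1);(239,1)].

Definition table3 : seq (seq (nat * nat)) :=
  [:: [:: (0,1);(0,2)];[:: (0,3);(0,4)];[:: (0,5);(0,6)];[:: (0,7);(135,3)];
  [:: (0,8);(60,0)];[:: (0,9);(0,10)];[:: (0,11);(600,1)];[:: (0,12);(0,13)];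
  [:: (0,14);(0,15)];[:: (0,16);(0,17)];[:: (0,18);(0,19)];[:: (0,20);
  (335,16)];[:: (62,17);(246,18)];[:: (0,21);(0,22)];[:: (0,23);(0,24)];
  [:: (0,25);(0,26)];[:: (0,27);(0,28)];[:: (0,29);(0,30)];[:: (0,31);(0,32)];
  [:: (0,33);(414,20)];[:: (0,34);(0,35)];[:: (0,36);(0,37)];[:: (0,38);
  (0,39)];[:: (0,40);(0,41)];[:: (586,30);(0,42)];[:: (0,43);(0,44)];
  [:: (0,45);(0,46)];[:: (0,47);(246,36)];[:: (0,48);(170,40)];[:: (1,0);
  (0,49)];[:: (620,6);(392,21)];[:: (0,50);(0,51)];[:: (0,52);(0,53)];
  [:: (0,54);(0,55)];[:: (0,56);(335,14)];[:: (0,57);(641,5)];[:: (455,41);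
  (0,58)];[:: (0,59);(438,9)];[:: (0,60);(0,61)];[:: (0,62);(0,63)];
  [:: (0,64);(0,65)];[:: (0,66);(0,67)];[:: (0,68);(0,69)];[:: (0,70);(0,71)];
  [:: (0,72);(0,73)];[:: (0,74);(0,75)];[:: (0,76);(0,77)];[:: (0,78);
  (152,70)];[:: (2,35);(0,79)];[:: (460,15);(0,80)];[:: (0,81);(0,82)];
  [:: (0,83);(0,84)];[:: (0,85);(0,86)];[:: (0,87);(0,88)];[:: (0,89);
  (263,25)];[:: (0,90);(530,81)];[:: (152,24);(0,91)];[:: (170,55);(267,68)];
  [:: (0,92);(0,93)];[:: (0,94);(644,66)];[:: (0,95);(0,96)];[:: (0,97);
  (0,98)];[:: (0,99);(62,54)];[:: (186,93);(0,7)];[:: (0,100);(122,50)];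
  [:: (122,28);(586,11)];[:: (306,79);(0,101)];[:: (0,102);(0,103)];
  [:: (503,49);(247,74)];[:: (0,104);(139,34)];[:: (272,42);(0,105)];
  [:: (340,44);(0,106)];[:: (0,107);(0,108)];[:: (0,109);(108,62)];
  [:: (0,110);(0,111)];[:: (0,112);(0,113)];[:: (0,114);(0,115)];[:: (0,116);
  (0,8)];[:: (0,2);(246,64)];[:: (0,117);(0,118)];[:: (0,119);(0,120)];
  [:: (2,91);(0,121)];[:: (0,122);(373,116)];[:: (0,123);(0,124)];
  [:: (58,106);(0,125)];[:: (0,126);(0,127)];[:: (0,128);(0,129)];
  [:: (319,103);(562,107)];[:: (45,69);(246,12)];[:: (0,130);(414,29)];
  [:: (263,65);(218,90)];[:: (0,131);(0,132)];[:: (0,133);(0,134)];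
  [:: (0,135);(152,100)];[:: (133,63);(132,56)];[:: (132,51);(447,109)];
  [:: (0,136);(0,137)];[:: (0,138);(0,139)];[:: (0,140);(376,99)];[:: (0,141);
  (167,133)];[:: (0,4);(455,27)];[:: (0,142);(0,143)];[:: (0,144);(0,145)];
  [:: (0,146);(0,147)];[:: (0,148);(627,47)];[:: (0,149);(0,150)];
  [:: (556,98);(0,151)];[:: (0,152);(0,153)];[:: (0,154);(0,155)];[:: (0,156);
  (0,157)];[:: (0,158);(0,159)];[:: (0,160);(0,161)];[:: (0,162);(0,163)];
  [:: (0,164);(42,123)];[:: (0,165);(0,166)];[:: (0,167);(0,168)];
  [:: (132,19);(0,78)];[:: (170,13);(0,169)];[:: (0,170);(0,171)];[:: (0,172);
  (0,173)];[:: (0,174);(641,89)];[:: (348,115);(0,175)];[:: (348,58);(0,176)];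
  [:: (348,22);(0,177)];[:: (0,178);(0,179)];[:: (0,180);(335,148)];
  [:: (0,181);(0,182)];[:: (0,183);(478,146)];[:: (0,184);(0,185)];
  [:: (0,186);(373,114)];[:: (348,77);(7,131)];[:: (2,10);(0,187)];
  [:: (258,118);(414,174)];[:: (0,188);(265,38)];[:: (0,189);(0,190)];
  [:: (588,161);(246,43)];[:: (0,191);(0,192)];[:: (222,39);(353,189)];
  [:: (447,108);(0,193)];[:: (0,194);(297,83)];[:: (0,195);(0,196)];
  [:: (470,139);(0,197)];[:: (290,32);(0,198)];[:: (0,199);(0,200)];
  [:: (288,187);(0,201)];[:: (0,202);(429,164)];[:: (0,203);(0,204)];
  [:: (0,205);(0,23)];[:: (0,206);(139,31)];[:: (455,204);(0,207)];
  [:: (0,208);(357,104)];[:: (0,209);(246,135)];[:: (0,210);(630,191)];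
  [:: (0,211);(56,144)];[:: (0,212);(0,213)];[:: (0,214);(0,215)];
  [:: (219,168);(38,140)];[:: (420,177);(399,119)];[:: (0,216);(0,217)];
  [:: (0,218);(546,186)];[:: (0,219);(157,167)];[:: (157,37);(632,57)];
  [:: (0,220);(0,221)];[:: (0,222);(0,223)];[:: (428,46);(0,224)];
  [:: (644,200);(132,126)];[:: (132,82);(373,52)];[:: (0,225);(130,180)];
  [:: (0,226);(0,227)];[:: (189,121);(0,228)];[:: (534,176);(0,229)];
  [:: (0,230);(246,205)];[:: (120,105);(0,231)];[:: (75,120);(607,95)];
  [:: (0,232);(246,94)];[:: (587,153);(469,33)];[:: (477,224);(464,208)];
  [:: (34,155);(58,45)];[:: (0,233);(404,141)];[:: (404,96);(283,97)];
  [:: (0,234);(127,158)];[:: (263,101);(459,76)];[:: (80,221);(0,235)];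
  [:: (11,223);(626,219)];[:: (0,236);(656,218)];[:: (512,143);(418,222)];
  [:: (86,190);(0,237)];[:: (0,238);(494,183)];[:: (0,166);(0,239)];
  [:: (364,67);(0,240)];[:: (265,217);(53,236)];[:: (318,228);(110,209)];
  [:: (0,241);(387,138)];[:: (386,179);(0,242)];[:: (626,137);(10,142)];
  [:: (156,242);(0,243)];[:: (0,244);(140,154)];[:: (0,245);(0,246)];
  [:: (439,129);(0,247)];[:: (0,248);(0,249)];[:: (311,113);(227,59)];
  [:: (451,185);(506,87)];[:: (389,237);(4,128)];[:: (191,247);(33,149)];
  [:: (230,215);(98,232)];[:: (7,88);(246,48)];[:: (627,147);(197,117)];
  [:: (103,150);(538,216)];[:: (500,229);(69,172)];[:: (215,227);(378,170)];
  [:: (0,250);(108,241)];[:: (278,151);(630,225)];[:: (0,251);(164,226)];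
  [:: (275,124);(552,156)];[:: (336,125);(576,206)];[:: (299,80);(500,230)];
  [:: (0,252);(0,253)];[:: (130,163);(413,160)];[:: (455,145);(118,112)];
  [:: (265,240);(625,130)];[:: (625,127);(428,220)];[:: (428,159);(0,254)];
  [:: (644,198);(0,255)];[:: (145,75);(546,184)];[:: (291,197);(0,256)];
  [:: (0,257);(359,212)];[:: (265,196);(625,233)];[:: (0,258);(625,181)];
  [:: (0,259);(603,214)];[:: (83,171);(262,152)];[:: (0,260);(127,72)];
  [:: (513,173);(105,122)];[:: (415,246);(641,85)];[:: (47,192);(616,211)];
  [:: (222,157);(152,210)];[:: (214,255);(0,261)];[:: (30,261);(0,262)];
  [:: (532,182);(0,263)];[:: (126,134);(0,264)];[:: (589,169);(0,265)];
  [:: (239,254);(201,60)];[:: (353,243);(510,195)];[:: (632,265);(580,136)];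
  [:: (160,213);(346,234)];[:: (341,73);(358,244)];[:: (60,132);(142,260)];
  [:: (118,256);(586,257)];[:: (419,263);(15,250)];[:: (532,235);(84,248)];
  [:: (223,262);(372,245)];[:: (340,71);(507,194)];[:: (630,61);(401,258)];
  [:: (0,26);(616,199)];[:: (134,264);(477,203)];[:: (353,249);(354,238)];
  [:: (244,201);(437,202)];[:: (67,231);(281,102)];[:: (265,239);(481,178)];
  [:: (156,175);(157,188)];[:: (552,193);(84,259)];[:: (298,207);(127,252)];
  [:: (173,253);(348,165)];[:: (656,111);(606,92)];[:: (290,53);(501,110)];
  [:: (494,86);(69,162)];[:: (51,84);(166,251)]].

(* Four levels of cosets: 1 < 11 < 11:5 < L_2(11) < J_1. *)
Section Certificate.
Variables (T : eqType) (op : T -> T -> T) (e y z : T).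

Let wd := word op e [:: y; z].

Definition gen0 : T := wd [:: 0; 1; 1].
Definition gen1 : T := wd [:: 0; 0; 0; 1; 1; 1; 0; 1; 0; 1; 0].
Definition gen2 : T := wd [:: 1; 0; 0; 1; 0; 0].

Definition reps0 : seq T := grow op e [:: gen0] tree0.
Definition reps1 : seq T := grow op e [:: gen0; gen1] tree1.
Definition reps2 : seq T := grow op e [:: gen0; gen1; gen2] tree2.
Definition reps3 : seq T := grow op e [:: y; z] tree3.

Definition els1 : seq T := prods op [:: e] reps0.
Definition els2 : seq T := prods op els1 reps1.
Definition els3 : seq T := prods op els2 reps2.

Definition certificate : bool :=
  [&& covers op e [:: e] [:: gen0] reps0 table0,
      covers op e els1 [:: gen0; gen1] reps1 table1,
      covers op e els2 [:: gen0; gen1; gen2] reps2 table2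
    & covers op e els3 [:: y; z] reps3 table3].

Lemma certificateE : certificate =
  [&& covers op e [:: e] [:: gen0] reps0 table0,
      covers op e els1 [:: gen0; gen1] reps1 table1,
      covers op e els2 [:: gen0; gen1; gen2] reps2 table2
    & covers op e els3 [:: y; z] reps3 table3].
Proof. by []. Qed.

Lemma reps0E : reps0 = grow op e [:: gen0] tree0. Proof. by []. Qed.
Lemma reps1E : reps1 = grow op e [:: gen0; gen1] tree1. Proof. by []. Qed.
Lemma reps2E : reps2 = grow op e [:: gen0; gen1; gen2] tree2. Proof. by []. Qed.
Lemma reps3E : reps3 = grow op e [:: y; z] tree3. Proof. by []. Qed.
Lemma els1E : els1 = prods op [:: e] reps0. Proof. by []. Qed.
Lemma els2E : els2 = prods op els1 reps1. Proof. by []. Qed.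
Lemma els3E : els3 = prods op els2 reps2. Proof. by []. Qed.

(* An elementary abelian subgroup of order 8. *)
Definition sylow2 : seq T :=
  prods op [:: e; wd [:: 0; 1; 0; 1; 1; 1; 1]]
    (prods op [:: e; wd [:: 1; 0; 1; 1; 1; 1; 0]]
              [:: e; wd [:: 0; 0; 1; 0; 0; 1; 1; 1; 1]]).

End Certificate.

Definition twd : seq nat -> table :=
  word mul_table one_table [:: y_table; z_table].

Definition gwd : seq nat -> {'GL_7(11)} :=
  word *%g 1%g [:: J1_Y; J1_Z].

Lemma glcodeYZ : map glcode [:: J1_Y; J1_Z] = [:: y_table; z_table].
Proof. by rewrite /= /glcode /= codeY codeZ. Qed.

Lemma glcode_word (w : seq nat) : glcode (gwd w) = twd w.
Proof. by rewrite /gwd (map_word glcodeM glcode1) glcodeYZ. Qed.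

Lemma gwd_eq (v w : seq nat) : (gwd v == gwd w) = (twd v == twd w).
Proof. by rewrite -!glcode_word (inj_eq glcode_inj). Qed.

Lemma gwd_cat (v w : seq nat) : gwd (v ++ w) = (gwd v * gwd w)%g.
Proof.
rewrite /gwd /word foldl_cat; move: (foldl _ 1%g v) => g.
elim/last_ind: w => [|w k IHw]; first by rewrite mulg1.
by rewrite !foldl_rcons IHw mulgA.
Qed.

Lemma mem_gwd (w : seq nat) : gwd w \in J1.
Proof.
apply: mem_word => x; rewrite !inE => /pred2P[]->; apply: mem_gen.
  exact: set21.
exact: set22.
Qed.

Lemma gwdX (w : seq nat) (n : nat) :
  gwd (flatten (nseq n w)) = (gwd w ^+ n)%g.
Proof. by elim: n => //= n IHn; rewrite gwd_cat IHn expgS. Qed.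

Lemma order_gwd (p : nat) (w : seq nat) :
  prime p -> twd (flatten (nseq p w)) == twd [::] -> twd w != twd [::] ->
  #[gwd w]%g = p.
Proof.
move=> p_pr; rewrite -!gwd_eq gwdX => /eqP wp1 w_neq1.
exact: nt_prime_order.
Qed.

Lemma certificate_tables : certificate mul_table one_table y_table z_table.
Proof. vm_compute. reflexivity. Qed.

Lemma certificateP : certificate *%g 1%g J1_Y J1_Z.
Proof.
set mg : {'GL_7(11)} -> {'GL_7(11)} -> {'GL_7(11)} := *%g.
set tg := map glcode.
have wE w : word mul_table one_table [:: y_table; z_table] w =
    glcode (word mg 1%g [:: J1_Y; J1_Z] w).
  by rewrite (map_word glcodeM glcode1) glcodeYZ.
have w0 : gen0 mul_table one_table y_table z_table =
    glcode (gen0 mg 1%g J1_Y J1_Z) by exact: wE.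
have w1 : gen1 mul_table one_table y_table z_table =
    glcode (gen1 mg 1%g J1_Y J1_Z) by exact: wE.
have w2 : gen2 mul_table one_table y_table z_table =
    glcode (gen2 mg 1%g J1_Y J1_Z) by exact: wE.
have g0 : [:: gen0 mul_table one_table y_table z_table] =
    tg [:: gen0 mg 1%g J1_Y J1_Z].
  by rewrite /tg /= w0.
have g1 : [:: gen0 mul_table one_table y_table z_table;
    gen1 mul_table one_table y_table z_table] =
    tg [:: gen0 mg 1%g J1_Y J1_Z; gen1 mg 1%g J1_Y J1_Z].
  by rewrite /tg /= w0 w1.
have g2 : [:: gen0 mul_table one_table y_table z_table;
    gen1 mul_table one_table y_table z_table;
    gen2 mul_table one_table y_table z_table] =
    tg [:: gen0 mg 1%g J1_Y J1_Z; gen1 mg 1%g J1_Y J1_Z; gen2 mg 1%g J1_Y J1_Z].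
  by rewrite /tg /= w0 w1 w2.
have g3 : [:: y_table; z_table] = tg [:: J1_Y; J1_Z] by rewrite /tg glcodeYZ.
have r0 : reps0 mul_table one_table y_table z_table =
    tg (reps0 mg 1%g J1_Y J1_Z).
  by rewrite !reps0E; exact: (map_grow glcodeM glcode1 _ g0).
have r1 : reps1 mul_table one_table y_table z_table =
    tg (reps1 mg 1%g J1_Y J1_Z).
  by rewrite !reps1E; exact: (map_grow glcodeM glcode1 _ g1).
have r2 : reps2 mul_table one_table y_table z_table =
    tg (reps2 mg 1%g J1_Y J1_Z).
  by rewrite !reps2E; exact: (map_grow glcodeM glcode1 _ g2).
have r3 : reps3 mul_table one_table y_table z_table =
    tg (reps3 mg 1%g J1_Y J1_Z).
  by rewrite !reps3E; exact: (map_grow glcodeM glcode1 _ g3).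
have e0 : [:: one_table] = tg [:: 1%g] by rewrite /tg /= glcode1.
have e1 : els1 mul_table one_table y_table z_table = tg (els1 mg 1%g J1_Y J1_Z).
  by rewrite !els1E; exact: (map_prods glcodeM e0 r0).
have e2 : els2 mul_table one_table y_table z_table = tg (els2 mg 1%g J1_Y J1_Z).
  by rewrite !els2E; exact: (map_prods glcodeM e1 r1).
have e3 : els3 mul_table one_table y_table z_table = tg (els3 mg 1%g J1_Y J1_Z).
  by rewrite !els3E; exact: (map_prods glcodeM e2 r2).
have := certificate_tables; rewrite !certificateE => /and4P[c0 c1 c2 c3].
apply/and4P; split.
- exact: (covers_map glcodeM glcode1 glcode_inj e0 g0 r0 c0).
- exact: (covers_map glcodeM glcode1 glcode_inj e1 g1 r1 c1).
- exact: (covers_map glcodeM glcode1 glcode_inj e2 g2 r2 c2).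
exact: (covers_map glcodeM glcode1 glcode_inj e3 g3 r3 c3).
Qed.

Lemma chain_card (gT : finGroupType) (G : {group gT}) (a b c y z : gT)
    (X0 X1 X2 X3 e1 e2 e3 : seq gT) (t0 t1 t2 t3 : seq (nat * nat))
    (b0 b1 b2 b3 : seq (seq (nat * nat))) :
    G = <<[set y; z]>>%G -> [/\ a \in G, b \in G & c \in G] ->
    X0 = grow *%g 1%g [:: a] t0 ->
    X1 = grow *%g 1%g [:: a; b] t1 ->
    X2 = grow *%g 1%g [:: a; b; c] t2 ->
    X3 = grow *%g 1%g [:: y; z] t3 ->
    e1 = prods *%g [:: 1%g] X0 -> e2 = prods *%g e1 X1 ->
    e3 = prods *%g e2 X2 ->
    covers *%g 1%g [:: 1%g] [:: a] X0 b0 ->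
    covers *%g 1%g e1 [:: a; b] X1 b1 ->
    covers *%g 1%g e2 [:: a; b; c] X2 b2 ->
    covers *%g 1%g e3 [:: y; z] X3 b3 ->
  #|G| <= (size t0).+1 * (size t1).+1 * (size t2).+1 * (size t3).+1.
Proof.
move=> GE [Ga Gb Gc] X0E X1E X2E X3E e1E e2E e3E c0 c1 c2 c3.
have sub0 : {subset [:: 1%g] <= (1%G : {group gT})} by move=> x; rewrite !inE.
have s01 : <<[set g in [:: a]]>>%G \subset <<[set g in [:: a; b]]>>%g.
  by apply: genS; apply/subsetP=> x; rewrite !inE => ->.
have s12 : <<[set g in [:: a; b]]>>%G \subset <<[set g in [:: a; b; c]]>>%g.
  by apply: genS; apply/subsetP=> x; rewrite !inE => /orP[] ->; rewrite ?orbT.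
have yzE : [set y; z] = [set g in [:: y; z]].
  by apply/setP=> x; rewrite !inE.
have s23 : <<[set g in [:: a; b; c]]>>%G \subset <<[set g in [:: y; z]]>>%g.
  rewrite -yzE -[<<_>>%g in X in _ \subset X]/(val <<[set y; z]>>%G) -GE.
  by rewrite gen_subG; apply/subsetP=> x; rewrite !inE => /or3P[] /eqP->.
have [n0] := card_gens_reps sub0 (sub1G _) X0E c0; rewrite -e1E => sub1.
have [n1] := card_gens_reps sub1 s01 X1E c1; rewrite -e2E => sub2.
have [n2] := card_gens_reps sub2 s12 X2E c2; rewrite -e3E => sub3.
have [n3 _] := card_gens_reps sub3 s23 X3E c3.
rewrite GE /= yzE; apply: leq_trans n3 _; rewrite leq_mul //.
apply: leq_trans n2 _; rewrite leq_mul //.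
apply: leq_trans n1 _; rewrite leq_mul //.
by apply: leq_trans n0 _; rewrite cards1 mul1n.
Qed.

Lemma certificate_card (gT : finGroupType) (y z : gT) :
  certificate *%g 1%g y z -> #|<<[set y; z]>>%G| <= 11 * 5 * 12 * 266.
Proof.
rewrite certificateE => /and4P[c0 c1 c2 c3].
have Gw w : word *%g 1%g [:: y; z] w \in <<[set y; z]>>%G.
  apply: mem_word => g; rewrite !inE => /pred2P[]->; apply: mem_gen.
    exact: set21.
  exact: set22.
have sz0 : (size tree0).+1 = 11 by [].
have sz1 : (size tree1).+1 = 5 by [].
have sz2 : (size tree2).+1 = 12 by [].
have sz3 : (size tree3).+1 = 266 by [].
rewrite -sz0 -sz1 -sz2 -sz3.
exact: (chain_card erefl (And3 (Gw _) (Gw _) (Gw _)) (reps0E _ _ _ _)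
          (reps1E _ _ _ _) (reps2E _ _ _ _) (reps3E _ _ _ _) (els1E _ _ _ _)
          (els2E _ _ _ _) (els3E _ _ _ _) c0 c1 c2 c3).
Qed.

Lemma leq_card_J1 : #|J1| <= 11 * 5 * 12 * 266.
Proof. exact: certificate_card certificateP. Qed.

Lemma order3 : #[gwd [:: 0; 0; 0; 1; 0; 1; 0; 1]%N]%g = 3.
Proof. by apply: order_gwd; vm_compute. Qed.

Lemma order5 : #[gwd [:: 1]%N]%g = 5.
Proof. by apply: order_gwd; vm_compute. Qed.

Lemma order7 : #[gwd [:: 0]%N]%g = 7.
Proof. by apply: order_gwd; vm_compute. Qed.

Lemma order11 : #[gwd [:: 0; 1; 1]%N]%g = 11.
Proof. by apply: order_gwd; vm_compute. Qed.

Lemma order19 : #[gwd [:: 0; 0; 0; 1]%N]%g = 19.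
Proof. by apply: order_gwd; vm_compute. Qed.

Definition sylow2_check (T : eqType) (op : T -> T -> T) (e y z : T) : bool :=
  let s := sylow2 op e y z in
  [&& uniq s, all (fun x => all (fun y => op x y \in s) s) s
    & all (fun x => all (fun y => (op x z == op z y) ==> (x == e)) s) s].

Lemma sylow2_checkP (gT : finGroupType) (G : {group gT}) (y z : gT) :
  y \in G -> z \in G -> sylow2_check *%g 1%g y z ->
  exists (E : {group gT}) (g : gT),
    [/\ E \subset G, #|E| = 8, g \in G & (E :&: E :^ g = 1)%g].
Proof.
move=> Gy Gz; rewrite /sylow2_check; set s := sylow2 _ _ _ _.
case/and3P=> s_uniq s_mul s_TI.
have s1 : 1%g \in s by rewrite /s /sylow2 /prods /= !mul1g mem_head.
have s_sub : {subset s <= G}.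
  have sg : {subset [:: y; z] <= G}.
    by move=> g; rewrite !inE => /pred2P[]->.
  move=> x; rewrite /s /sylow2.
  case/allpairsP=> -[x1 x23] /= [x1P /allpairsP[[x2 x3] /= [x2P x3P ->]] ->].
  have G1w w u : u \in [:: 1%g; word *%g 1%g [:: y; z] w] -> u \in G.
    rewrite !inE => /pred2P[]->; [exact: group1 | exact: mem_word sg].
  by apply: groupM; [|apply: groupM]; apply: G1w; eassumption.
have s_size : size s = 8 by [].
clearbody s.
have E_group : group_set [set x in s].
  apply/group_setP; split=> [|x t]; first by rewrite inE.
  rewrite !inE => s_x s_t.
  by have /allP/(_ t s_t) := allP s_mul x s_x.
exists (Group E_group), (z^-1)%g; split.
- by apply/subsetP=> x; rewrite inE; apply: s_sub.
- by rewrite cardsE (card_uniqP s_uniq).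
- by rewrite groupV.
apply/trivgP/subsetP=> x /setIP[]; rewrite mem_conjg invgK !inE => s_x s_xz.
have /allP/(_ _ s_xz)/implyP := allP s_TI x s_x.
by apply; rewrite conjgE mulKVg.
Qed.

Lemma sylow2_check_map (T U : eqType) (opT : T -> T -> T) (opU : U -> U -> U)
    (eT y z : T) (eU : U) (f : T -> U) :
  {morph f : u v / opT u v >-> opU u v} -> f eT = eU -> injective f ->
  sylow2_check opU eU (f y) (f z) -> sylow2_check opT eT y z.
Proof.
move=> fM f1 f_inj; rewrite /sylow2_check.
have -> : sylow2 opU eU (f y) (f z) = map f (sylow2 opT eT y z).
  have wE w : word opU eU [:: f y; f z] w = f (word opT eT [:: y; z] w).
    by rewrite (map_word fM f1).
  by do 2?[apply: (map_prods fM)]; rewrite /= f1 wE.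
set s := sylow2 _ _ _ _; rewrite (map_inj_uniq f_inj) !all_map.
clearbody s; case/and3P=> -> /allP s_mul /allP s_TI /=; apply/andP; split.
  apply/allP=> x s_x; apply/allP=> t s_t.
  have /= := s_mul x s_x; rewrite all_map => /allP s_mul_x.
  by have := s_mul_x t s_t; rewrite /= -fM (mem_map f_inj).
apply/allP=> x s_x; apply/allP=> t s_t.
have /= := s_TI x s_x; rewrite all_map => /allP s_TI_x.
by have := s_TI_x t s_t; rewrite /= -!fM -f1 !(inj_eq f_inj).
Qed.

Lemma sylow2_J1 : exists (E : {group {'GL_7(11)}}) (g : {'GL_7(11)}),
  [/\ E \subset J1, #|E| = 8, g \in J1 & (E :&: E :^ g = 1)%g].
Proof.
have tables : sylow2_check mul_table one_table (glcode J1_Y) (glcode J1_Z).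
  by rewrite /glcode codeY codeZ; vm_compute.
have checked : sylow2_check *%g 1%g J1_Y J1_Z.
  exact: (sylow2_check_map glcodeM glcode1 glcode_inj tables).
have Jy : J1_Y \in J1 by apply: mem_gen; apply: set21.
have Jz : J1_Z \in J1 by apply: mem_gen; apply: set22.
exact: sylow2_checkP Jy Jz checked.
Qed.

Lemma order_bound : 11 * 5 * 12 * 266 = 2 ^ 3 * 3 * 5 * 7 * 11 * 19.
Proof. lia. Qed.

Theorem card_J1 : #|J1| = 2 ^ 3 * 3 * 5 * 7 * 11 * 19.
Proof.
apply/eqP; rewrite eqn_leq -{1}order_bound leq_card_J1 /=.
apply: dvdn_leq; first exact: cardG_gt0.
have [E [g [sEJ1 card_E _ _]]] := sylow2_J1.
have dvd_mul n m k : coprime m k -> m %| n -> k %| n -> m * k %| n.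
  by move=> co_mk m_dv k_dv; rewrite Gauss_dvd // m_dv.
have dvd_order p (w : seq nat) : #[gwd w]%g = p -> p %| #|J1|.
  by move=> <-; apply: order_dvdG; apply: mem_gwd.
have dvd8 : 2 ^ 3 %| #|J1|.
  by have -> : 2 ^ 3 = #|E|; [rewrite card_E | apply: cardSg].
apply: (dvd_mul _ _ _ _ _ (dvd_order _ _ order19)); first by rewrite !coprimeMl.
apply: (dvd_mul _ _ _ _ _ (dvd_order _ _ order11)); first by rewrite !coprimeMl.
apply: (dvd_mul _ _ _ _ _ (dvd_order _ _ order7)); first by rewrite !coprimeMl.
apply: (dvd_mul _ _ _ _ _ (dvd_order _ _ order5)); first by rewrite !coprimeMl.
exact: (dvd_mul _ _ _ _ dvd8 (dvd_order _ _ order3)).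
Qed.

Lemma normal_J1_odd (N : {group {'GL_7(11)}}) (p : nat) (u v : seq nat) :
    (N <| J1)%g -> prime p -> p %| #|N| -> logn p #|J1| = 1 ->
    [&& twd (flatten (nseq p u)) == twd [::],
        twd (flatten (nseq p (u ++ [:: 0]))) == twd [::],
        twd (flatten (nseq p v)) == twd [::]
      & twd (flatten (nseq p (v ++ [:: 1]))) == twd [::]] ->
  N :=: J1.
Proof.
move=> nsNJ p_pr p_dv_N logp; rewrite -!gwd_eq !gwdX.
have [sNJ nNJ] := andP nsNJ; have [x Nx ox] := Cauchy p_pr p_dv_N.
have sylP : (p.-Sylow(J1) <[x]>)%g.
  rewrite pHallE cycle_subG (subsetP sNJ) //= -orderE ox p_part logp.
  by rewrite expn1.
have N_word (w : seq nat) : (gwd w ^+ p == gwd [::])%g -> gwd w \in N.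
  move=> /eqP wp1.
  have pw : (p.-group <[gwd w]>)%g.
    apply: (pnat_dvd (n := p)); last exact: pnat_id.
    by rewrite -orderE order_dvdn; apply/eqP.
  have sw : <[gwd w]>%g \subset J1 by rewrite cycle_subG mem_gwd.
  have [g Jg] := Sylow_subJ sylP sw pw.
  rewrite cycle_subG => w_xg; apply: (subsetP _ _ w_xg).
  by rewrite -(normsP nNJ g Jg) conjSg cycle_subG.
case/and4P=> /N_word Nu /N_word Nuy /N_word Nv /N_word.
have N_cancel w t : gwd w \in N -> gwd (w ++ t) \in N -> gwd t \in N.
  by rewrite gwd_cat => Nw; rewrite groupMl.
move/(N_cancel _ _ Nv) => Nz; move/(N_cancel _ _ Nu): Nuy => Ny.
apply/eqP; rewrite eqEsubset sNJ gen_subG; apply/subsetP=> g.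
rewrite !inE => /pred2P[]->.
  by rewrite /gwd /word /= mul1g in Ny.
by rewrite /gwd /word /= mul1g in Nz.
Qed.

Lemma normal_J1_2group (N : {group {'GL_7(11)}}) :
  (N <| J1)%g -> (2.-group N)%g -> N :=: 1%g.
Proof.
move=> nsNJ N2; have [E [g [sEJ card_E Jg tiE]]] := sylow2_J1.
have sylE : (2.-Sylow(J1) E)%g.
  by rewrite pHallE sEJ card_E card_J1 p_part !lognM.
have sNE : N \subset E.
  exact: subset_trans (pcore_max N2 nsNJ) (pcore_sub_Hall sylE).
apply/trivgP; rewrite -tiE subsetI sNE /=.
by rewrite -(normsP (normal_norm nsNJ) _ Jg) conjSg.
Qed.

Theorem simple_J1 : simple J1.
Proof.
have log_J1 p : logn p #|J1| = logn p 8 + logn p 3 + logn p 5 + logn p 7 +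
    logn p 11 + logn p 19.
  by rewrite card_J1 !lognM ?muln_gt0.
apply/simpleP; split=> [|N nsNJ].
  by rewrite -cardG_gt1 card_J1 -[1%N]/(1 * 1)%N ltn_mul.
have [N2 | ] := boolP (2.-group N)%g.
  by left; apply: normal_J1_2group.
rewrite /pgroup /pnat cardG_gt0 /= => /allPn[p].
rewrite mem_primes cardG_gt0 /= => /andP[p_pr p_dv_N] p_neq2; right.
have : p %| #|J1| by apply: dvdn_trans p_dv_N (cardSg (normal_sub nsNJ)).
rewrite card_J1 !Euclid_dvdM // !dvdn_prime2 //=.
have {}p_neq2 : p == 2 = false by apply: negbTE.
rewrite p_neq2 /= => /orP[/orP[/orP[/orP[]|]|]|] /eqP p_E; subst p.
- apply: (normal_J1_odd (u := [:: 1; 0; 0; 1; 0; 0; 1; 1; 1; 0; 1; 1])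
    (v := [:: 0; 0; 0; 1; 0; 1; 0; 1]) nsNJ p_pr p_dv_N).
    by rewrite log_J1.
  by vm_compute.
- apply: (normal_J1_odd (u := [:: 0; 1; 0; 1])
    (v := [::]) nsNJ p_pr p_dv_N).
    by rewrite log_J1.
  by vm_compute.
- apply: (normal_J1_odd (u := [::])
    (v := [:: 0; 0; 0; 1; 0; 1; 1; 0; 0]) nsNJ p_pr p_dv_N).
    by rewrite log_J1.
  by vm_compute.
- apply: (normal_J1_odd (u := [:: 0; 1; 1])
    (v := [:: 0; 0; 1; 1; 0; 0; 1; 0; 1]) nsNJ p_pr p_dv_N).
    by rewrite log_J1.
  by vm_compute.
- apply: (normal_J1_odd (u := [:: 0; 1; 1; 1; 1])
    (v := [:: 0; 0; 0; 1; 0; 0]) nsNJ p_pr p_dv_N).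
    by rewrite log_J1.
  by vm_compute.
Qed.

(* Main.v *)
Require Import Defs.
From mathcomp Require Import all_boot all_fingroup matrix cyclic.
From mathcomp Require Import zify.

(* For every triple other than (2,3,5), explicit words u, v in Janko's
   generators Y and Z give elements of orders p, q and product of order r, and
   further words express Y and Z through u and v.  For (2,3,5), put b for the
   element of order 3 and c for the product of order 5: the relations
   c^5 = b^3 = 1 and b c^-1 b = c (the last one saying that b c^-1 is an
   involution) force <b, c> to be the union of the cosets of <c> with
   representatives 1, b c^j, b c^2 b c^j and b c^2 b c b, as in the alternating
   group A_5 acting on the vertices of an icosahedron.  So the group has order
   at most 60, and is not J_1. *)

Set Implicit Arguments.
Unset Strict Implicit.
Unset Printing Implicit Defensive.

(** * Coset enumeration over [<[c]>] for groups of type (2,3,5) *)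

Section Icosahedral.

Local Open Scope group_scope.

Variables (gT : finGroupType) (b c d z : gT).
Hypotheses (b3 : b ^+ 3 = 1) (c5 : c ^+ 5 = 1) (bVcb : b * c^-1 * b = c).
Hypotheses (dE : b * c ^+ 2 * b = d) (zE : d * c * b = z).

(** Both sides are [b^-1]. This lemma and the following ones bring a representative times [b] or [c]
    to the form: power of [c] times a representative. *)
Lemma icosa_bb : b * b = c^-1 * b * c^-1.
Proof.
have -> : c^-1 * b * c^-1 = b^-1.
  by apply: (mulgI b); rewrite !mulgA bVcb !mulgV.
by apply: (mulgI b); rewrite mulgV -b3 !expgS expg0 mulg1.
Qed.

(** Trades negative powers of [c] for positive ones and back; the coset table only has exponents 0
    to 4. *)
Lemma icosa_cV (i j : nat) : (i + j = 5)%N -> c^-1 ^+ i = c ^+ j.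
Proof.
by move=> ij; rewrite expgVn; apply: (mulgI (c ^+ i)); rewrite mulgV -expgD ij.
Qed.

(** Writing the middle [c] as [b * c^-1 * b] creates two squares of [b]; after [icosa_bb], the power
    between the two remaining [b] is [c^-3 = c^2]. *)
Lemma icosa_bcb : b * c * b = c^-1 * d * c^-1.
Proof.
rewrite -[in LHS]bVcb !mulgA icosa_bb -(mulgA _ b b) icosa_bb -dE.
by rewrite -(@icosa_cV 3 2) // !expgS expg0 mulg1 !mulgA.
Qed.

(** Expanding both [c] on the right by [bVcb] puts [b^3 = 1] in the middle and leaves
    [b * c^-2 * b]. *)
Lemma icosa_bc3b : b * c ^+ 3 * b = c * b * c.
Proof.
rewrite -(@icosa_cV 2 3) // -[in RHS]bVcb !mulgA.
have bbb x : x * b * b * b = x.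
  by rewrite -!mulgA -[b * (b * b)]/(b ^+ 3) b3 mulg1.
by rewrite bbb.
Qed.

Lemma icosa_bc4b : b * c ^+ 4 * b = c.
Proof. by rewrite -(@icosa_cV 1 4). Qed.

Lemma icosa_db : d * b = c^-1 * d * c^-1 ^+ 2.
Proof.
by rewrite -[in LHS]dE -mulgA icosa_bb !mulgA mulgK icosa_bcb -!mulgA.
Qed.

(** Expanding both factors of [c ^+ 2] inside [d] by [bVcb] yields three squares of [b]; [icosa_bb]
    and [c^-3 = c^2] then give the equation solved for [d]. *)
Lemma icosa_dc2b : d * c ^+ 2 * b = c * d * c.
Proof.
suff {2}-> : d = c^-1 * (d * c ^+ 2 * b) * c^-1.
  by rewrite !mulgA mulgV mul1g mulgKV.
rewrite -[in LHS]dE expgS expg1 -[in LHS]bVcb !mulgA icosa_bb.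
rewrite -(mulgA _ b b) icosa_bb !mulgA -(mulgA _ b b) icosa_bb.
have cc x : x * c * c = x * c^-1 * c^-1 * c^-1.
  by rewrite -!mulgA -[c * c]/(c ^+ 2) -(@icosa_cV 3 2).
by rewrite -dE !mulgA !cc.
Qed.

Lemma icosa_dc3b : d * c ^+ 3 * b = c * b * c ^+ 2.
Proof.
rewrite -dE -(mulgA _ b) -(mulgA _ (b * _)) icosa_bc3b (mulgA _ (c * b)).
by rewrite (mulgA _ c b) -(mulgA b) -expgSr icosa_bc3b -mulgA.
Qed.

Lemma icosa_dc4b : d * c ^+ 4 * b = b * c ^+ 3.
Proof.
by rewrite -dE -(mulgA _ b) -(mulgA _ (b * _)) icosa_bc4b -mulgA -expgSr.
Qed.

Lemma icosa_zb : z * b = c^-1 * d * c^-1 ^+ 3.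
Proof.
rewrite -zE -mulgA icosa_bb !mulgA mulgK icosa_db.
by rewrite -!mulgA.
Qed.

(** Thus [c] fixes the coset of [z], the vertex opposite to that of 1. Using [icosa_bcb] twice turns
    [z] into [c^-1 * z * c^-1]. *)
Lemma icosa_zc : z * c = c^-1 * z.
Proof.
suff {1}-> : z = c^-1 * z * c^-1 by rewrite mulgKV.
rewrite -[in LHS]zE -dE -!mulgA (mulgA b c b) icosa_bcb.
by rewrite !mulgA mulgK -[in LHS]dE !mulgA icosa_bcb mulgKV -zE !mulgA.
Qed.

Definition icosa_reps : seq gT :=
  1 :: [seq b * c ^+ j | j <- iota 0 5] ++ [seq d * c ^+ j | j <- iota 0 5]
    ++ [:: z].

(** First entries give the action of [c]: it fixes positions 0 and 11 and cycles through 1 to 5 and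
    through 6 to 10. A factor 4 stands for [c^-1]. *)
Definition icosa_table : seq (seq (nat * nat)) :=
  [:: [:: (1, 0); (0, 1)];
      [:: (0, 2); (4, 5)]; [:: (0, 3); (4, 10)]; [:: (0, 4); (0, 6)];
      [:: (0, 5); (1, 2)]; [:: (0, 1); (1, 0)];
      [:: (0, 7); (4, 9)]; [:: (0, 8); (0, 11)]; [:: (0, 9); (1, 7)];
      [:: (0, 10); (1, 3)]; [:: (0, 6); (0, 4)];
      [:: (4, 11); (4, 8)]]%N.

Lemma icosa_covers :
  covers *%g 1 [seq c ^+ i | i <- iota 0 5] [:: c; b] icosa_reps icosa_table.
Proof.
have cV1 : c^-1 = c ^+ 4 by exact: (@icosa_cV 1 4).
have cV2 : c^-1 ^+ 2 = c ^+ 3 by exact: (@icosa_cV 2 3).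
have cV3 : c^-1 ^+ 3 = c ^+ 2 by exact: (@icosa_cV 3 2).
rewrite /covers /= !expg0 !expg1 !mulg1 !mul1g !eqxx /=.
rewrite icosa_bb icosa_bcb dE icosa_bc3b icosa_bc4b icosa_db zE icosa_dc2b.
rewrite icosa_dc3b icosa_dc4b icosa_zc icosa_zb cV2 cV3 cV1.
rewrite -!mulgA.
(* This closes the two 5-cycles of [c]. *)
have cc : c * (c * (c * (c * c))) = 1 by exact: c5.
by rewrite cc !mulg1 !eqxx.
Qed.

Lemma card_icosahedral : #|<<[set c; b]>>| <= 60.
Proof.
have -> : [set c; b] = [set x in [:: c; b]] by apply/setP=> x; rewrite !inE.
apply: leq_trans (@leq_card_coset_cover _ <[c]> _ _ _ _ _ _ icosa_covers) _.
- by move=> _ /mapP[i _ ->]; apply: mem_cycle.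
- exact: mem_head.
rewrite -[60]/(5 * 12)%N leq_mul //.
by apply: dvdn_leq; rewrite // order_dvdn c5.
Qed.

End Icosahedral.

Lemma card_triple235 (gT : finGroupType) (G : {group gT}) :
  triple_generated G 2 3 5 -> #|G| <= 60.
Proof.
case=> a [b [[_ _ ->] [oa ob oab]]].
have aV : a^-1%g = a by apply: (mulgI a); rewrite mulgV -[LHS](expg_order a) oa.
(* The role of [c] is played by [a * b], so that [b * c^-1] is the involution [a]. *)
have -> : <<[set a; b]>>%g = <<[set (a * b)%g; b]>>%g.
  have b_in x : b \in <<[set x; b]>>%g by rewrite mem_gen ?set22.
  apply/eqP; rewrite eqEsubset !gen_subG; apply/andP.
  split; apply/subsetP=> x /set2P[]->; rewrite ?b_in //.
    by rewrite -(groupMr _ (b_in _)) mem_gen ?set21.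
  by rewrite groupMr ?b_in // mem_gen ?set21.
apply: (card_icosahedral (d := (b * (a * b) ^+ 2 * b)%g) _ _ _ erefl erefl).
- by rewrite -ob expg_order.
- by rewrite -oab expg_order.
by rewrite invMg aV mulgA mulgV mul1g.
Qed.

(** * Certificates of generation, checked on tables *)

Definition subst_word (u v s : seq nat) : seq nat :=
  flatten [seq nth [::] [:: u; v] k | k <- s].

(** Reduces membership of [J1_Y] and [J1_Z] in the subgroup generated by two words to an equality of
    tables. *)
Lemma mem_gwd_subst (u v s : seq nat) :
  gwd (subst_word u v s) \in <<[set gwd u; gwd v]>>%g.
Proof.
elim: s => [|k s IHs]; first exact: group1.
rewrite /subst_word /= gwd_cat groupM //.
case: k => [|[|k]] /=; first by rewrite mem_gen ?set21.
  by rewrite mem_gen ?set22.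
(* Letters other than 0 and 1 become the empty word, of value 1. *)
by rewrite nth_nil; apply: group1.
Qed.

(** Primality of [p] makes these two table comparisons enough to determine the order. *)
Definition has_order (p : nat) (w : seq nat) : bool :=
  [&& prime p, twd (flatten (nseq p w)) == twd [::] & twd w != twd [::]].

Lemma has_orderP (p : nat) (w : seq nat) : has_order p w -> #[gwd w]%g = p.
Proof. by case/and3P; apply: order_gwd. Qed.

Definition certifies (t : nat * nat * nat) (uv st : seq nat * seq nat) : bool :=
  let: (p, q, r) := t in let: (u, v) := uv in
  [&& has_order p u, has_order q v, has_order r (u ++ v),
      twd (subst_word u v st.1) == twd [:: 0]
    & twd (subst_word u v st.2) == twd [:: 1]].

Lemma certifies_triple (p q r : nat) (uv st : seq nat * seq nat) :
  certifies (p, q, r) uv st -> triple_generated J1 p q r.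
Proof.
case: uv => u v /and5P[/has_orderP ou /has_orderP ov /has_orderP ouv].
rewrite -!gwd_eq => /eqP eqY /eqP eqZ; exists (gwd u), (gwd v).
split; last by rewrite ou ov -ouv gwd_cat.
split; rewrite ?mem_gwd //; apply/eqP; rewrite eqEsubset !gen_subG.
apply/andP; split; apply/subsetP=> x; rewrite !inE => /pred2P[]->;
  try exact: mem_gwd.
  have -> : J1_Y = gwd [:: 0] by rewrite /gwd /word /= mul1g.
  by rewrite -eqY mem_gwd_subst.
have -> : J1_Z = gwd [:: 1] by rewrite /gwd /word /= mul1g.
by rewrite -eqZ mem_gwd_subst.
Qed.

(* An entry ((p, q, r), (u, v), (s, t)): u and v are words in Y and Z, while s
   and t are words in u and v that evaluate to Y and Z. *)
Definition certificates :
    seq (nat * nat * nat * (seq nat * seq nat) * (seq nat * seq nat)) :=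
  [::
   ((2, 3, 7),
    ([:: 0; 1; 0; 1; 1; 1; 1], [:: 0; 0; 1; 0; 1; 0; 1; 0]),
    ([:: 0; 1; 1; 0; 1; 0; 1; 1; 0; 1; 0; 1; 1; 0; 1; 1; 0; 1; 0; 1; 0; 1; 1;
      0; 1; 1; 0; 1; 0; 1; 0; 1; 1; 0; 1; 0; 1; 0; 1; 1; 0; 1; 0; 1; 1; 0; 1],
      [:: 0; 1; 0; 1; 0; 1; 0; 1; 1; 0; 1; 1; 0; 1; 0; 1; 1; 0; 1; 0; 1; 0; 1;
      1; 0; 1; 1; 0; 1; 0; 1; 1]));
   ((2, 3, 11),
    ([:: 1; 1; 0; 1; 0; 1; 1], [:: 0; 1; 0; 1; 0; 0; 0; 1; 1]),
    ([:: 1; 0; 1; 1; 0; 1; 0; 1; 0; 1; 0; 1; 1; 0; 1; 0; 1; 0; 1; 0; 1; 1; 0;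
      1; 0], [:: 1; 0; 1; 1; 0; 1; 0; 1; 1; 0; 1; 0; 1; 1; 0; 1; 0; 1; 0; 1;
      1; 0; 1; 0; 1; 1; 0; 1; 0; 1; 1; 0; 1; 0]));
   ((2, 3, 19),
    ([:: 0; 1; 0; 1; 1; 1; 1], [:: 1; 0; 1; 1; 1; 0; 1; 1]),
    ([:: 0; 1; 0; 1; 0; 1; 0; 1; 1; 0; 1; 0; 1; 1; 0; 1; 0; 1; 0; 1; 1; 0; 1;
      1; 0; 1; 0; 1; 1; 0; 1; 1; 0; 1; 0; 1], [:: 1; 0; 1; 0; 1; 0; 1; 0; 1;
      0; 1; 0; 1; 1; 0; 1; 0; 1; 1; 0; 1; 0; 1; 1; 0; 1; 0; 1; 0; 1]));
   ((2, 5, 7),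
    ([:: 0; 0; 0; 1; 0; 0; 1; 1; 1], [:: 1]),
    ([:: 0; 1; 1; 0; 1; 1; 1; 1; 0; 1; 1; 0; 1; 1; 1; 0; 1; 0; 1; 1; 1; 1],
      [:: 1]));
   ((2, 5, 11),
    ([:: 0; 0; 1; 1; 1; 0; 0; 1; 0], [:: 1; 1]),
    ([:: 0; 1; 0; 1; 0; 1; 0; 1; 1; 1; 0; 1; 0; 1; 0; 1; 1; 0; 1; 1; 1; 0; 1;
      0; 1; 1; 0; 1], [:: 1; 1; 1]));
   ((2, 5, 19),
    ([:: 0; 1; 1; 1; 1; 0; 1], [:: 1; 1]),
    ([:: 1; 0; 1; 0; 1; 0; 1; 0; 1; 0; 1; 0; 1; 0; 1; 0; 1; 0; 1; 1; 1], [::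
      1; 1; 1]));
   ((2, 7, 11),
    ([:: 1; 0; 1; 0; 1; 1; 1], [:: 0; 0]),
    ([:: 1; 1; 1; 1], [:: 1; 1; 0; 1; 1; 0; 1; 1; 1; 1; 1; 1; 0; 1; 1; 0; 1;
      0; 1; 0; 1; 1; 1; 1]));
   ((2, 7, 19),
    ([:: 1; 1; 0; 1; 0; 1; 1], [:: 0]),
    ([:: 1], [:: 1; 1; 1; 0; 1; 1; 0; 1; 1; 0; 1; 0; 1; 1; 1; 1; 0; 1; 1; 1]));
   ((2, 11, 19),
    ([:: 0; 1; 1; 1; 1; 0; 1], [:: 1; 0; 0; 1]),
    ([:: 1; 0; 1; 1; 1; 0; 1; 0; 1; 1; 1; 0; 1; 1; 1; 1; 1; 1; 1; 1; 0], [::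
      1; 0; 1; 1; 1; 1; 1; 0; 1; 1; 1; 1; 1; 0; 1; 1; 1; 1; 0; 1; 1; 0]));
   ((3, 5, 7),
    ([:: 0; 0; 0; 1; 1; 0; 1; 0; 1], [:: 1; 1; 1]),
    ([:: 0; 0; 1; 1; 0; 1; 1; 0; 1; 1; 0; 1; 1; 1; 0; 1; 0; 0; 1], [:: 1; 1]));
   ((3, 5, 11),
    ([:: 0; 0; 1; 0; 1; 0; 1; 1; 0], [:: 1; 1]),
    ([:: 1; 1; 1; 0; 1; 0; 0; 1; 0; 0; 1; 1; 0; 0; 1; 0; 0; 1; 0; 1], [:: 1;
      1; 1]));
   ((3, 5, 19),
    ([:: 0; 1; 0; 0; 0; 1; 0; 1], [:: 1]),
    ([:: 1; 0; 0; 1; 0; 1; 0; 1; 0; 1; 0; 1; 0; 1; 0; 0], [:: 1]));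
   ((3, 7, 11),
    ([:: 0; 1; 0; 1; 0; 0; 0; 1], [:: 0; 0]),
    ([:: 1; 1; 1; 1], [:: 0; 1; 0; 1; 1; 0; 1; 0; 1; 0; 1; 1; 1; 1; 1; 0; 0;
      1; 0; 1]));
   ((3, 7, 19),
    ([:: 0; 1; 1; 1; 0; 1; 1; 1], [:: 0]),
    ([:: 1], [:: 0; 1; 0; 0; 1; 1; 0; 0; 1; 0; 1; 1; 0; 0; 1; 1; 0; 1; 1]));
   ((3, 11, 19),
    ([:: 1; 0; 1; 1; 1; 0; 1; 1], [:: 1; 0; 1]),
    ([:: 0; 1; 0; 1; 1; 1; 1; 1; 0; 1; 0; 1], [:: 0; 0; 1; 1; 1; 1; 0; 0; 1;
      0; 1; 1; 1; 1; 0; 1; 1; 0]));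
   ((5, 7, 11),
    ([:: 1; 1], [:: 0]),
    ([:: 1], [:: 0; 0; 0]));
   ((5, 7, 19),
    ([:: 1], [:: 0; 0; 0]),
    ([:: 1; 1; 1; 1; 1], [:: 0]));
   ((5, 11, 19),
    ([:: 1; 1], [:: 0; 1; 1]),
    ([:: 1; 0; 0; 0; 0], [:: 0; 0; 0]));
   ((7, 11, 19),
    ([:: 0], [:: 0; 1; 1; 0; 1; 1]),
    ([:: 0], [:: 1; 1; 1; 1; 1; 0; 1; 1; 1; 1; 1; 0]))].

Lemma certificates_ok : all (fun e => certifies e.1.1 e.1.2 e.2) certificates.
Proof. by vm_compute. Qed.

Lemma certified_triple (p q r : nat) :
  (p, q, r) \in [seq e.1.1 | e <- certificates] -> triple_generated J1 p q r.
Proof.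
case/mapP=> -[[t uv] st] e_in tE; apply: (@certifies_triple _ _ _ uv st).
by rewrite tE; apply: (allP certificates_ok _ e_in).
Qed.

Theorem theorem2p8 (p q r : nat)
    (hp : p \in [:: 2; 3; 5; 7; 11; 19])
    (hq : q \in [:: 2; 3; 5; 7; 11; 19])
    (hr : r \in [:: 2; 3; 5; 7; 11; 19])
    (hpq : p < q) (hqr : q < r) :
  triple_generated J1 p q r <-> (p, q, r) <> (2, 3, 5).
Proof.
split=> [gen_pqr [p2 q3 r5] | neq235].
  rewrite p2 q3 r5 in gen_pqr.
  by have := card_triple235 gen_pqr; rewrite card_J1; lia.
apply: certified_triple; set triples := map _ _.
set primes19 := [:: 2; 3; 5; 7; 11; 19] in hp hq hr.
(* Of the twenty increasing triples, nineteen have a certificate; [neq235] excludes the other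
   one. *)
have complete : all (fun p => all (fun q => all (fun r =>
    (p < q < r) ==> ((p, q, r) \in (2, 3, 5) :: triples))
    primes19) primes19) primes19 by vm_compute.
move/allP/(_ p hp)/allP/(_ q hq)/allP/(_ r hr): complete.
by rewrite hpq hqr inE => /predU1P[].
Qed.
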